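(* Let $G$ be a finite group, $F\leq G$ a subgroup, $\mathcal{C}$ the conjugacy class of $F$ in $G$ (the set of all subgroups of $G$ conjugate to $F$), and $n$ a positive integer dividing $|G|$. Then $$\sum_{H\in\mathcal{C}}\ \sum_{\substack{H\leq K\leq G\\ |K|\,\mid\, n}}\gamma(H,K)\equiv 0 \pmod n .$$ That is, $n$ divides $|\mathcal{C}|$ times the number of $g\in G$ for which $|\langle F,g\rangle|$ divides $n$.
   Context: For subgroups $H,K$ of a finite group $G$, $\gamma(H,K)=|\{g\in K\mid K=\langle H,g\rangle\}|$, where $\langle H,g\rangle$ is the subgroup generated by $H$ and $g$. *)

(* Defs.v *)
From mathcomp Require Import all_boot all_fingroup.

Set Implicit Arguments.
Unset Strict Implicit.
Unset Printing Implicit Defensive.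

Import GroupScope.

Definition gamma (gT : finGroupType) (H K : {group gT}) : nat :=
  #|[set g in K | K :==: <<g |: H>>]|.

(* The orbit of F under the conjugation action 'JG of G on the type {group gT},
   so that its elements are subgroups and not merely sets. *)
Definition conj_class (gT : finGroupType) (G F : {group gT}) :
    {set {group gT}} := orbit 'JG G F.

(* Main.v *)
(* Let N = |G| and let X_n count the pairs (H, g) with H in C, g in G and |<H,g>|
   dividing n. For every G-set W, N divides the number of triples (H, g, w) with
   w in W fixed by <H,g>, as in Burnside's lemma. For W the m-subsets of G under
   translation, the number of points fixed by K depends only on |K| and N, so it
   can be computed in the cyclic group of order N; there the orbit decomposition
   writes it as sum_(d | m) c_d * (N/d) * [|K| divides d] with c_m = 1. Hence N
   divides sum_(d | m) c_d * (N/d) * X_d, and by strong induction on m, N divides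
   (N/m) * X_m, that is, m divides X_m. *)
Require Import Defs.
From mathcomp Require Import all_boot all_fingroup.
From mathcomp Require Import zmodp cyclic.

Set Implicit Arguments.
Unset Strict Implicit.
Unset Printing Implicit Defensive.

Import GroupScope.

(* The number of m-subsets of a group of order N that are invariant under
   translation by a subgroup of order k. *)
Definition subset_mark (N m k : nat) : nat :=
  if k %| m then 'C(N %/ k, m %/ k) else 0.

(** * Subsets invariant under a free action *)

Lemma orbit_free_card (aT : finGroupType) (rT : finType)
  (to : {action aT &-> rT}) (K : {group aT}) (x : rT) :
  'C_K[x | to] = 1 -> #|orbit to K x| = #|K|.
Proof. by move=> free; rewrite -(card_orbit_stab to K x) free cards1 muln1. Qed.

Lemma free_acts_card (aT : finGroupType) (rT : finType)
  (to : {action aT &-> rT}) (K : {group aT}) (S : {set rT}) :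
  {in S, forall x, 'C_K[x | to] = 1} -> [acts K, on S | to] ->
  #|S| = (#|[set orbit to K x | x in S]| * #|K|)%N.
Proof.
move=> free /orbit_partition; apply: card_uniform_partition => _ /imsetP[x Sx ->].
by rewrite orbit_free_card ?free.
Qed.

(** An invariant subset is a union of [K]-orbits, all of size [#|K|] by freeness, so it amounts to a
    choice of [m %/ #|K|] among the [#|D| %/ #|K|] orbits in [D]. *)
Lemma card_invariant_subsets (aT : finGroupType) (rT : finType)
  (to : {action aT &-> rT}) (K : {group aT}) (D : {set rT}) (m : nat) :
  [acts K, on D | to] -> {in D, forall x, 'C_K[x | to] = 1} ->
  #|[set S : {set rT} | [&& S \subset D, #|S| == m & [acts K, on S | to]]]|
    = subset_mark #|D| m #|K|.
Proof.
move=> actD free; set I := [set S | _].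
pose orbs (S : {set rT}) := [set orbit to K x | x in S].
have cardI S : S \in I -> m = (#|orbs S| * #|K|)%N.
  rewrite inE => /and3P[/subsetP sSD /eqP <-]; apply: free_acts_card => x /sSD.
  exact: free.
rewrite /subset_mark; case: ifPn => [dvd_m | ndvd_m]; last first.
  apply/eqP; rewrite cards_eq0; apply/eqP/setP => S; rewrite in_set0.
  by apply: contraNF ndvd_m => /cardI->; rewrite dvdn_mull.
have K_gt0 := cardG_gt0 K.
have coverK S : S \in I -> cover (orbs S) = S.
  by rewrite inE => /and3P[_ _ /orbit_partition/cover_partition].
have injI : {in I &, injective orbs}.
  by move=> S S' IS IS' eqSS'; rewrite -(coverK S) // eqSS' coverK.
have Dorbs : #|D| %/ #|K| = #|orbs D|.
  by rewrite (free_acts_card free actD) mulnK.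
(* The binomial counts sets of orbits. It remains to see that [orbs] maps [I] onto those of the
   right size; the preimage of [B] is [cover B]. *)
rewrite -(card_in_imset injI) Dorbs -cards_draws; congr #|pred_of_set _|.
apply/setP=> B; rewrite inE; apply/imsetP/andP => [[S IS ->] | [sBD /eqP cardB]].
  rewrite (cardI S IS) mulnK //; split=> //.
  by move: IS; rewrite inE => /and3P[sSD _ _]; apply: imsetS.
have actB : [acts K, on cover B | to].
  apply/subsetP=> a Ka; rewrite !inE; apply/subsetP=> x /bigcupP[C BC Cx].
  rewrite inE; apply/bigcupP; exists C => //.
  have /imsetP[y _ defC] := subsetP sBD C BC.
  rewrite defC in Cx *; case/orbitP: Cx => b Kb <-.
  by rewrite -actM mem_orbit ?groupM.
have orbsB : orbs (cover B) = B.
  have orbB C y : C \in B -> y \in C -> orbit to K y = C.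
    move=> BC; have /imsetP[x _ ->] := subsetP sBD C BC.
    by move=> Ky; apply: orbit_eqP.
  apply/setP=> C; apply/imsetP/idP=> [[y /bigcupP[C' BC' C'y] ->] | BC].
    by rewrite (orbB C').
  have /imsetP[x _ defC] := subsetP sBD C BC.
  have Cx : x \in C by rewrite defC orbit_refl.
  by exists x; [apply/bigcupP; exists C | rewrite (orbB C)].
have sBD' : cover B \subset D.
  apply/bigcupsP=> C BC; have /imsetP[x Dx ->] := subsetP sBD C BC.
  by rewrite acts_sub_orbit.
exists (cover B) => //; rewrite inE sBD' actB andbT /=.
rewrite (free_acts_card _ actB) => [|x /(subsetP sBD')]; last exact: free.
by rewrite -/(orbs _) orbsB cardB divnK.
Qed.

Lemma card_right_invariant_subsets (gT : finGroupType) (G K : {group gT}) (m : nat) :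
  K \subset G ->
  #|[set S in [set S : {set gT} | S \subset G & #|S| == m]
       | K \subset 'C[S | 'R^*]]| = subset_mark #|G| m #|K|.
Proof.
move=> sKG; rewrite -(@card_invariant_subsets _ _ 'R%act K G m).
- apply: eq_card => S; rewrite !inE astab1_set /= -andbA.
  by rewrite subsetI subsetT.
- apply/subsetP=> a Ka; rewrite !inE; apply/subsetP=> x Gx.
  by rewrite inE /= groupM // (subsetP sKG).
- by move=> x _; rewrite astab1R setIg1.
Qed.

(** * Translation orbits on subsets of a cyclic group *)

Lemma acts_on_subsets (gT : finGroupType) (G : {group gT}) (m : nat) :
  [acts G, on [set S : {set gT} | S \subset G & #|S| == m] | 'R^*].
Proof.
apply/actsP=> a Ga S; rewrite !inE /= /setact card_imset; last exact: act_inj.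
congr (_ && _); apply/subsetP/subsetP => sSG x.
  by move=> Sx; rewrite -(groupMr _ Ga) sSG //; apply: imset_f.
by case/imsetP=> y Sy ->; apply: groupM Ga; apply: sSG.
Qed.

(* c d is the number of translation orbits on m-subsets of A with stabiliser of
   order d. *)
Lemma cyclic_subset_mark_expansion (gT : finGroupType) (A : {group gT}) (m : nat) :
  cyclic A -> m %| #|A| ->
  exists2 c : nat -> nat, c m = 1%N & forall k, k %| #|A| ->
    subset_mark #|A| m k = \sum_(d < m.+1 | d %| m) (k %| d) * (c d * (#|A| %/ d)).
Proof.
move=> cycA dvd_m; have A_gt0 := cardG_gt0 A.
have m_gt0 : 0 < m by apply: dvdn_gt0 dvd_m.
pose D := [set S : {set gT} | S \subset A & #|S| == m].
pose st (S : {set gT}) := 'C_A[S | 'R^*]%G.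
pose Dd d := [set S in D | #|st S| == d].
have DdE d S : (S \in Dd d) = (S \in D) && (#|st S| == d) by rewrite inE.
have actD : [acts A, on D | 'R^*] by apply: acts_on_subsets.
have actDd d : [acts A, on Dd d | 'R^*].
  apply/actsP=> a Aa S; rewrite !DdE (actsP actD) //.
  congr (_ && (_ == _)); rewrite /st /= astab1_act.
  by rewrite -{1}(conjGid Aa) -conjIg cardJg.
have [c card_Dd] : exists c : nat -> nat, forall d, #|Dd d| = (c d * (#|A| %/ d))%N.
  exists (fun d => #|[set orbit 'R^* A S | S in Dd d]|) => d.
  apply: card_uniform_partition (orbit_partition (actDd d)).
  move=> _ /imsetP[S + ->]; rewrite inE => /andP[_ /eqP <-].
  by rewrite -(card_orbit_stab 'R^* A S) mulnK ?cardG_gt0.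
(* [S] is a union of orbits of its own stabiliser, which translates freely. *)
have st_dvd S : S \in D -> #|st S| %| m.
  rewrite inE => /andP[sSA /eqP <-].
  rewrite (@free_acts_card _ _ 'R%act (st S) S) ?dvdn_mull //.
    by move=> x _; rewrite astab1R setIg1.
  by rewrite -astab1_set subsetIr.
have st_lt S : S \in D -> #|st S| < m.+1.
  by rewrite ltnS => /st_dvd; apply: dvdn_leq.
have mark k : k %| #|A| ->
    subset_mark #|A| m k = \sum_(d < m.+1 | d %| m) (k %| d) * (c d * (#|A| %/ d)).
  move=> dvd_k; have [B sBA oB] : exists2 B : {group gT}, B \subset A & #|B| = k.
    have /cyclicP[a defA] := cycA; rewrite defA in dvd_k *.
    move/cycle_sub_group/setP/(_ <[a ^+ (#[a] %/ k)]>%G): (dvd_k).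
    by rewrite !inE eqxx => /andP[? /eqP ?]; exists <[a ^+ (#[a] %/ k)]>%G.
  rewrite -oB -card_right_invariant_subsets // -/D.
  (* In a cyclic group, inclusion of subgroups is divisibility of their orders; hence the
     coefficient [k %| d]. *)
  have subst S : (B \subset 'C[S | 'R^*]) = (k %| #|st S|).
    rewrite -oB (cardSg_cyclic cycA) ?subsetIl //.
    by rewrite [RHS]subsetI sBA.
  rewrite -sum1_card.
  (* [inord] loses nothing here, since the stabilisers have order at most [m]. *)
  rewrite (partition_big (fun S => inord #|st S| : 'I_m.+1)
             (fun d : 'I_m.+1 => d %| m)) /=; last first.
    move=> S; rewrite inE => /andP[DS _].
    by rewrite (inordK (st_lt S DS)) st_dvd.
  apply: eq_bigr => d dvd_d; rewrite oB -card_Dd -sum1_card.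
  case: (boolP (k %| d)) => kd; rewrite ?mul1n ?mul0n.
    apply: eq_bigl => S; rewrite DdE inE -andbA.
    case: (boolP (S \in D)) => //= DS; rewrite subst.
    rewrite -val_eqE /= (inordK (st_lt S DS)).
    by apply/andP/idP => [[]//|/eqP->].
  apply: big1 => S /andP[]; rewrite inE subst => /andP[DS].
  move=> kS /eqP defd; case/negP: kd.
  by rewrite -defd (inordK (st_lt S DS)).
exists c => //; apply/eqP.
have Nm_gt0 : 0 < #|A| %/ m by rewrite divn_gt0 // dvdn_leq.
rewrite -(eqn_pmul2r Nm_gt0) mul1n; apply/eqP.
(* At [k = m] the mark is ['C(#|A| %/ m, 1)], and on the right only [d = m] satisfies both [d %| m]
   and [m %| d]. *)
have := mark m dvd_m; rewrite /subset_mark dvdnn divnn m_gt0 bin1.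
rewrite (bigD1 (Ordinal (ltnSn m))) //= dvdnn mul1n big1 ?addn0 => [<- //|d].
by case/andP=> dm; rewrite -val_eqE /= eqn_dvd dm /= => /negbTE->.
Qed.

(** Only the order of the group enters the formula, so a cyclic group of order [N] supplies the
    coefficients. *)
Lemma subset_mark_expansion (N m : nat) : 0 < N -> m %| N ->
  exists2 c : nat -> nat, c m = 1%N & forall k, k %| N ->
    subset_mark N m k = \sum_(d < m.+1 | d %| m) (k %| d) * (c d * (N %/ d)).
Proof.
case: N => // n _; rewrite -(order_Zp1 n).
exact/cyclic_subset_mark_expansion/cycle_cyclic.
Qed.

(** * Fixed-point counts and divisibility *)

(* Exchanging the sums, a point w with stabiliser W contributes
   #|W| * #|{H in C | H <= W}|, which is constant along the orbit of w. *)
Lemma dvdn_sum_fix (gT : finGroupType) (rT : finType) (to : {action gT &-> rT})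
  (G F : {group gT}) (D : {set rT}) :
  F \subset G -> [acts G, on D | to] ->
  #|G| %| \sum_(H in conj_class G F) \sum_(g in G)
             #|[set w in D | <<g |: H>> \subset 'C[w | to]]|.
Proof.
move=> sFG actD.
pose nC w := #|[set H in conj_class G F | H \subset 'C[w | to]]|.
have -> : \sum_(H in conj_class G F) \sum_(g in G)
             #|[set w in D | <<g |: H>> \subset 'C[w | to]]|
        = \sum_(w in D) nC w * #|'C_G[w | to]|.
  (* The subgroup generated by [g] and [H] fixes [w] exactly when both [g] and [H] do, so the count
     factors once [w] is fixed. *)
  transitivity (\sum_(H in conj_class G F) \sum_(g in G) \sum_(w in D)
                  (H \subset 'C[w | to]) * (g \in 'C[w | to])).
    apply: eq_bigr => H _; apply: eq_bigr => g _.
    rewrite -sum1_card big_mkcond [RHS]big_mkcond; apply: eq_bigr => w _.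
    rewrite inE gen_subG subUset sub1set; case: (w \in D) => //=.
    by case: (g \in _); case: (H \subset _).
  under eq_bigr do rewrite exchange_big /=.
  rewrite exchange_big; apply: eq_bigr => w _ /=.
  under eq_bigr do rewrite -big_distrr /=.
  rewrite -big_distrl /=; congr (_ * _)%N; rewrite /nC -sum1_card.
    rewrite big_mkcond [RHS]big_mkcond; apply: eq_bigr => H _; rewrite inE.
    by case: (H \in _); case: (_ \subset _).
  rewrite big_mkcond [RHS]big_mkcond; apply: eq_bigr => g _; rewrite in_setI.
  by case: (g \in G); case: (_ \in _).
rewrite (set_partition_big _ (orbit_partition actD)) /=.
apply: dvdn_sum => _ /imsetP[x Dx ->].
(* Conjugation by [a] permutes the class and carries the stabiliser of [x] to that of [to x a]. *)
have nC_orbit a : a \in G -> nC (to x a) = nC x.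
  move=> Ga; rewrite /nC astab1_act.
  rewrite -(card_imset [set H in conj_class G F | H \subset 'C[x | to]]
              (act_inj 'JG a)).
  congr #|pred_of_set _|; apply/setP=> H; rewrite inE.
  apply/andP/imsetP => [[CH sH] | [L + ->]].
    exists ('JG%act H a^-1); last by rewrite actKV.
    by rewrite inE [_ \in _]orbit_actr ?groupV //= sub_conjgV; apply/andP.
  by rewrite inE => /andP[CL sL]; rewrite [_ \in _]orbit_actr //= conjSg.
(* By orbit-stabiliser, the whole orbit contributes [nC x * #|G|]. *)
rewrite (eq_bigr (fun=> (nC x * #|'C_G[x | to]|)%N)).
  by rewrite sum_nat_const mulnCA card_orbit_stab dvdn_mull.
move=> _ /orbitP[a Ga <-]; rewrite nC_orbit //; congr (_ * _)%N.
by rewrite astab1_act -{1}(conjGid Ga) -conjIg cardJg.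
Qed.

Lemma dvdn_card_generating_pairs (gT : finGroupType) (G F : {group gT}) (n : nat) :
  F \subset G -> n %| #|G| ->
  n %| \sum_(H in conj_class G F) \sum_(g in G) (#|<<g |: H>>| %| n).
Proof.
move=> sFG.
pose X m := \sum_(H in conj_class G F) \sum_(g in G) (#|<<g |: H>>| %| m).
rewrite -/(X n) => n_dvd; have G_gt0 := cardG_gt0 G.
have n_gt0 : 0 < n by apply: dvdn_gt0 n_dvd.
(* The factor [#|G| %/ n] is kept because the expansion of the marks produces the terms
   [#|G| %/ d * X d]. *)
suff: #|G| %| #|G| %/ n * X n.
  by rewrite -{1}(divnK n_dvd) dvdn_pmul2l // divn_gt0 // dvdn_leq.
elim/ltn_ind: n n_dvd {n_gt0} => m IHm m_dvd.
have m_gt0 : 0 < m by apply: dvdn_gt0 m_dvd.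
have [c cm mark] := subset_mark_expansion G_gt0 m_dvd.
have sCG H : H \in conj_class G F -> H \subset G.
  by case/orbitP=> a Ga <- /=; rewrite -(conjGid Ga) conjSg.
have := dvdn_sum_fix sFG (acts_on_subsets G m).
have -> : \sum_(H in conj_class G F) \sum_(g in G)
    #|[set S in [set S : {set gT} | S \subset G & #|S| == m]
         | <<g |: H>> \subset 'C[S | 'R^*]]|
  = \sum_(d < m.+1 | d %| m) c d * (#|G| %/ d * X d).
  transitivity (\sum_(H in conj_class G F) \sum_(g in G)
     \sum_(d < m.+1 | d %| m) (#|<<g |: H>>| %| d) * (c d * (#|G| %/ d))).
    apply: eq_bigr => H /sCG sHG; apply: eq_bigr => g Gg.
    have sG : <<g |: H>> \subset G by rewrite gen_subG subUset sub1set Gg.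
    by rewrite card_right_invariant_subsets // mark // cardSg.
  under eq_bigr do rewrite exchange_big /=.
  rewrite exchange_big; apply: eq_bigr => d _ /=.
  under eq_bigr do rewrite -big_distrl /=.
  by rewrite -big_distrl /= mulnC mulnA.
(* The term [d = m] has coefficient 1; the induction hypothesis covers all the others. *)
rewrite (bigD1 (Ordinal (ltnSn m))) //= cm mul1n.
rewrite dvdn_addl //; apply: dvdn_sum => d /andP[dm neq_dm]; apply: dvdn_mull.
apply: IHm; last exact: dvdn_trans dm m_dvd.
by rewrite ltn_neqAle neq_dm dvdn_leq.
Qed.

(** * From generating pairs to [gamma] *)

(** Sort the elements [g] by the subgroup [K] that they generate with [H]: each admissible [K]
    receives [gamma H K] of them. *)
Lemma sum_gamma (gT : finGroupType) (G H : {group gT}) (n : nat) :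
  H \subset G ->
  \sum_(K : {group gT} | [&& H \subset K, K \subset G & #|K| %| n]) gamma H K
    = \sum_(g in G) (#|<<g |: H>>| %| n).
Proof.
move=> sHG.
rewrite [RHS](bigID (fun g => #|<<g |: H>>| %| n)) /= [X in (_ + X)%N]big1 ?addn0.
  rewrite [RHS](partition_big (fun g => <<g |: H>>%G)
    (fun K : {group gT} => [&& H \subset K, K \subset G & #|K| %| n])) /=.
    apply: eq_bigr => K /and3P[sHK sKG dK].
    rewrite /gamma -sum1_card; apply: eq_big => g; last first.
      by rewrite inE => /andP[_ /eqP <-]; rewrite dK.
    have -> : (<<g |: H>>%G == K) = (K :==: <<g |: H>>) by rewrite eq_sym.
    rewrite inE.
    case: eqP => [defK | _]; rewrite ?andbF //= !andbT -defK dK andbT.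
    have Kg : g \in K by rewrite defK mem_gen ?setU11.
    by rewrite Kg (subsetP sKG).
  move=> g /andP[Gg ->]; rewrite andbT gen_subG subUset sub1set Gg sHG !andbT.
  by rewrite sub_gen ?subsetUr.
by move=> g /andP[_ /negbTE->].
Qed.

(** If [H] is the conjugate of [F] by [a], the substitution of [g ^ a] for [g] conjugates the
    generated subgroup and keeps its order. *)
Lemma card_generating_conj (gT : finGroupType) (G F H : {group gT}) (n : nat) :
  H \in conj_class G F ->
  \sum_(g in G) (#|<<g |: H>>| %| n) = #|[set g in G | #|<<g |: F>>| %| n]|.
Proof.
case/orbitP=> a Ga <-; rewrite -sum1_card big_mkcond [RHS]big_mkcond /=.
rewrite (reindex_inj (conjg_inj a)); apply: eq_bigr => g _ /=.
rewrite memJ_norm ?(subsetP (normG G) a Ga) // [in RHS]inE.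
rewrite -conjg_set1 -conjUg genJ cardJg.
by case: (g \in G); case: (_ %| _).
Qed.

Theorem theorem6p1 (gT : finGroupType) (G F : {group gT}) (n : nat)
  (sFG : F \subset G) (n_gt0 : 0 < n) (n_dvd : n %| #|G|) :
  \sum_(H in conj_class G F)
     \sum_(K : {group gT} | [&& H \subset K, K \subset G & #|K| %| n])
        gamma H K = 0 %[mod n]
  /\ n %| #|conj_class G F| * #|[set g in G | #|<<g |: F>>| %| n]|.
Proof.
have dvdX := dvdn_card_generating_pairs sFG n_dvd; split.
  rewrite mod0n; apply/eqP; rewrite -/(n %| _).
  rewrite (eq_bigr (fun H : {group gT} => \sum_(g in G) (#|<<g |: H>>| %| n))) //.
  move=> _ /orbitP[a Ga <-]; apply: sum_gamma.
  by rewrite /= -(conjGid Ga) conjSg.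
by rewrite -sum_nat_const -(eq_bigr _ (fun H CH => card_generating_conj n CH)).
Qed.
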